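(* Let $p$ be an odd prime, $S$ a finite $p$-group and $\mathcal{F}$ a saturated fusion system on $S$. Let $E$ be an $\mathcal{F}$-essential subgroup of $S$ such that $E$ has rank $2$, $\Phi(E)$ has rank at most $3$, and $E$ is not $\mathcal{F}$-characteristic in $S$. Then $E$ is an $\mathcal{F}$-pearl.
   Context: Rank: minimal size of a generating set. For $P\le S$, $\mathrm{Aut}_{\mathcal{F}}(P)=\mathrm{Hom}_{\mathcal{F}}(P,P)$, $\mathrm{Out}_{\mathcal{F}}(P)=\mathrm{Aut}_{\mathcal{F}}(P)/\mathrm{Inn}(P)$, $P^{\mathcal{F}}=\{P\alpha:\alpha\in\mathrm{Hom}_{\mathcal{F}}(P,S)\}$. $E\le S$ is $\mathcal{F}$-essential if $C_S(P)\le P$ and $|N_S(E)|\ge|N_S(P)|$ for all $P\in E^{\mathcal{F}}$, and $\mathrm{Out}_{\mathcal{F}}(E)$ has a strongly $p$-embedded subgroup. $E$ is $\mathcal{F}$-characteristic in $S$ if $E$ is normalized by $\mathrm{Aut}_{\mathcal{F}}(S)$. An $\mathcal{F}$-pearl is an $\mathcal{F}$-essential subgroup that is either elementary abelian of order $p^2$ or non-abelian of order $p^3$. *)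

(* Defs.v *)
From mathcomp Require Import all_boot all_order all_fingroup all_solvable.
Set Implicit Arguments. Unset Strict Implicit. Unset Printing Implicit Defensive.
Local Open Scope group_scope.

Section FusionDefs.
Variable gT : finGroupType.

Lemma grank_ex (G : {group gT}) :
  exists n, [exists A : {set gT}, (#|A| == n) && (<<A>> == G)].
Proof. exists #|G|; apply/existsP; exists (G : {set gT}); by rewrite eqxx genGid eqxx. Qed.
Definition grank (G : {group gT}) : nat := ex_minn (grank_ex G).

(* ---------- maps on subgroups, encoded as finite functions that are the
   identity outside their domain ---------- *)
Definition inj_hom_on (P : {set gT}) (f : {ffun gT -> gT}) : bool :=
  [&& [forall x in P, forall y in P, f (x * y) == f x * f y],
      [forall x in P, forall y in P, (f x == f y) ==> (x == y)] &
      [forall x, (x \notin P) ==> (f x == x)]].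

Definition cmap (P : {set gT}) (s : gT) : {ffun gT -> gT} :=
  [ffun x => if x \in P then x ^ s else x].

Definition fcomp (P : {set gT}) (f g : {ffun gT -> gT}) : {ffun gT -> gT} :=
  [ffun x => if x \in P then g (f x) else x].

Definition finv_on (P : {set gT}) (f : {ffun gT -> gT}) : {ffun gT -> gT} :=
  [ffun y => if y \in f @: P then odflt y [pick x in P | f x == y] else y].

(* A fusion system is given by  homF P = Hom_F(P,S)  for P <= S. *)
Definition fusion_system (S : {group gT})
    (homF : {set gT} -> {set {ffun gT -> gT}}) : Prop :=
  [/\
      forall (P : {set gT}) f, f \in homF P ->
        [&& group_set P, P \subset S, inj_hom_on P f & f @: P \subset S],
      forall (P : {group gT}) s, P \subset S -> s \in S -> cmap P s \in homF P,
      (* each morphism is an F-isomorphism onto its image followed by inclusion *)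
      forall (P : {group gT}) f, f \in homF P -> finv_on P f \in homF (f @: P) &
      forall (P Q : {group gT}) f g, f \in homF P -> g \in homF Q ->
        f @: P \subset Q -> fcomp P f g \in homF P].

Definition Fclass (homF : {set gT} -> {set {ffun gT -> gT}}) (P : {set gT})
  : {set {set gT}} := [set f @: P | f : {ffun gT -> gT} in homF P].

Definition fully_normalized S homF (P : {set gT}) : Prop :=
  forall Q, Q \in Fclass homF P -> #|'N_S(Q)| <= #|'N_S(P)|.
Definition fully_centralized S homF (P : {set gT}) : Prop :=
  forall Q, Q \in Fclass homF P -> #|'C_S(Q)| <= #|'C_S(P)|.

Definition AutF (homF : {set gT} -> {set {ffun gT -> gT}}) (P : {set gT})
  : {set {perm gT}} := [set a in Aut P | pval a \in homF P].
Definition AutS (S P : {set gT}) : {set {perm gT}} :=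
  [set a in Aut P | [exists s in 'N_S(P), pval a == cmap P s]].
Definition InnSet (P : {set gT}) : {set {perm gT}} :=
  [set a in Aut P | [exists x in P, pval a == cmap P x]].
Definition Inn (P : {set gT}) : {group {perm gT}} := <<InnSet P>>%G.

Definition OutF homF (P : {set gT}) : {set coset_of (Inn P)} :=
  (AutF homF P / Inn P)%g.

Definition Nphi (S P : {set gT}) (f : {ffun gT -> gT}) : {set gT} :=
  [set g in 'N_S(P) | [exists t in 'N_S(f @: P),
       [forall x in P, f (x ^ g) == (f x) ^ t]]].

Definition saturated_fusion_system (p : nat) (S : {group gT})
    (homF : {set gT} -> {set {ffun gT -> gT}}) : Prop :=
  [/\ fusion_system S homF,
      forall P : {group gT}, P \subset S -> fully_normalized S homF P ->
        fully_centralized S homF P /\ p.-Sylow(AutF homF P) (AutS S P) &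
      forall (P : {group gT}) f, P \subset S -> f \in homF P ->
        fully_centralized S homF (f @: P) ->
        exists2 h, h \in homF (Nphi S P f) & {in P, forall x, h x = f x}].

End FusionDefs.

Definition strongly_p_embedded (rT : finGroupType) (p : nat)
    (G : {set rT}) (M : {group rT}) : Prop :=
  [/\ M \proper G, p %| #|M| &
      forall x, x \in G -> x \notin M -> ~~ (p %| #|M :&: M :^ x|)].

Definition F_essential (gT : finGroupType) (p : nat) (S : {group gT})
    (homF : {set gT} -> {set {ffun gT -> gT}}) (E : {group gT}) : Prop :=
  [/\ E \subset S,
      forall P, P \in Fclass homF E -> 'C_S(P) \subset P /\ #|'N_S(P)| <= #|'N_S(E)| &
      exists M : {group coset_of (Inn E)}, strongly_p_embedded p (OutF homF E) M].

Definition F_characteristic (gT : finGroupType) (S : {group gT})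
    (homF : {set gT} -> {set {ffun gT -> gT}}) (E : {set gT}) : Prop :=
  forall a, a \in homF S -> a @: E = E.

Definition F_pearl (gT : finGroupType) (p : nat) (S : {group gT})
    (homF : {set gT} -> {set {ffun gT -> gT}}) (E : {group gT}) : Prop :=
  F_essential p S homF E /\
  ((p.-abelem E && (#|E| == p ^ 2)%N) \/ (~~ abelian E && (#|E| == p ^ 3)%N)).

(* Main.v *)
(* Put K = Phi(E) and N = N_S(E). The automorphisms of E in Aut_F(E) stabilising a
   chain K <= X <= E with X characteristic form a normal p-subgroup, hence lie in
   Inn(E) because Out_F(E) has a strongly p-embedded subgroup. Consequently
   |N : E| = p, [E, N] is not contained in K, and no characteristic subgroup of E
   lies strictly between K and E. Since E is not F-characteristic, some automorphism
   f of N moves E: conjugation by an element of N_S(N) if E is not normal in S, an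
   element of Aut_F(S) otherwise. The rest is group theory inside N.
   - K is f-invariant: otherwise N induces on the homocyclic group E / [E,E]Phi(K), of
     exponent p ^ 2, an automorphism g of order p with (g - 1)^3 = 0 and
     p (g - 1)^2 = 0, so that p (g - 1) = g ^ p - 1 = 0, which is absurd.
   - E centralises K / Phi(K), which has order at most p ^ 3: otherwise E / K acts
     faithfully, and comparing [K, E] with its image under f shows that E :&: f(E)
     or [E, N] acts trivially.
   - Hence K / Phi(K) is generated by the image of one commutator, so K is cyclic,
     central in E and equal to [E, E], which has order dividing p. *)
Require Import Defs.
From mathcomp Require Import all_boot all_order all_fingroup all_solvable.
Set Implicit Arguments.
Unset Strict Implicit.
Unset Printing Implicit Defensive.
Local Open Scope group_scope.

(** * Commutators, centralisers and power maps in finite p-groups *)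

Section PGroupLemmas.
Variables (gT : finGroupType) (p : nat).
Implicit Types A B G H K L N E R T U V W X Y : {group gT}.

Lemma comm_sub_prime_index N X Y :
    prime p -> p.-group N -> X <| N -> Y <| N -> Y \subset X -> #|X : Y| = p ->
  [~: X, N] \subset Y.
Proof.
move=> pr_p pN nsXN nsYN sYX iXY; have nYN := normal_norm nsYN.
have nYX := subset_trans (normal_sub nsXN) nYN.
have oXY: #|X / Y| = p by rewrite card_quotient.
have ntXY: X / Y != 1 by rewrite -cardG_gt1 oXY prime_gt1.
have pr: [~: X / Y, N / Y] \proper X / Y.
  apply: (nil_comm_properl (pgroup_nil (quotient_pgroup Y pN))) => //.
    by rewrite quotientS ?normal_sub.
  by rewrite subsetI subxx normal_norm // quotient_normal.
have := proper_card pr; have := cardSg (proper_sub pr); rewrite /= oXY.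
case/primeP: (pr_p) => _ dvd_p /dvd_p/pred2P[o1 _|->]; last by rewrite ltnn.
by rewrite -quotient_cents2 // (sameP commG1P eqP) trivg_card1 o1.
Qed.

(** If [G] moves some [v] in [V], then [v] and the nontrivial group ['C_V(G)] generate [V], so
    ['C_G(V)] is the centraliser of [v]. The class of [v] lies in a coset of the proper subgroup
    [[~: V, G]], of order at most [p]. *)
Lemma index_cent_card_le_p2 G V :
    prime p -> p.-group G -> V <| G -> #|V| <= p ^ 2 -> #|G : 'C_G(V)| <= p.
Proof.
move=> pr_p pG nsVG oV; have [sVG nVG] := andP nsVG.
have [-> | ntV] := eqVneq V 1%G.
  by rewrite (setIidPl _) ?cents1 // indexgg prime_gt0.
have [cVG | /subsetPn[v Vv ncv]] := boolP (V \subset 'C(G)).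
  by rewrite (setIidPl _) 1?centsC // indexgg prime_gt0.
have pV := pgroupS sVG pG.
have p_dvd_lt (H : {group gT}) : H \proper V -> #|H| <= p.
  move=> ltHV; have [n oVn] := p_natP pV.
  have [m oHm] := p_natP (pgroupS (proper_sub ltHV) pV).
  have := proper_card ltHV; rewrite oVn oHm ltn_exp2l ?prime_gt1 // => lt_mn.
  have le_n2: n <= 2 by rewrite oVn leq_exp2l ?prime_gt1 in oV.
  by rewrite -{2}(expn1 p) leq_exp2l ?prime_gt1 // -ltnS (leq_trans lt_mn).
have ltR: [~: V, G] \proper V.
  by apply: nil_comm_properl (pgroup_nil pG) sVG ntV _; rewrite subsetI subxx.
have ltC: 'C_V(G) \proper V.
  by rewrite properE subsetIl; apply/subsetPn; exists v; rewrite // inE Vv.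
have ltCv: 'C_V(G) <*> <[v]> = V.
  apply/eqP; rewrite eqEsubset join_subG subsetIl cycle_subG Vv /=.
  apply: contraT => nsV.
  have ltJ: 'C_V(G) <*> <[v]> \proper V.
    by rewrite properE nsV join_subG subsetIl cycle_subG Vv.
  have ltCJ: 'C_V(G) \proper 'C_V(G) <*> <[v]>.
    rewrite properE joing_subl; apply/subsetPn; exists v.
      by rewrite mem_gen // inE cycle_id orbT.
    by rewrite inE Vv.
  have := leq_trans (proper_card ltCJ) (p_dvd_lt _ ltJ).
  have : 1 < #|'C_V(G)|.
    rewrite cardG_gt1; apply: contra ntV => /eqP C1.
    apply/eqP/group_inj/(TI_center_nil (pgroup_nil pG) nsVG).
    by rewrite /center setIA (setIidPl sVG).
  have [k ->] := p_natP (pgroupS (proper_sub ltC) pV).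
  case: k => [|k]; first by rewrite ltnn.
  by move=> _; rewrite ltnNge -{1}(expn1 p) leq_exp2l ?prime_gt1.
have eqC: 'C_G(V) = 'C_G[v].
  have cGC: G \subset 'C('C_V(G)) by rewrite centsC subsetIr.
  by rewrite -ltCv centY setIA (setIidPl cGC) cent_cycle.
rewrite eqC index_cent1.
apply: leq_trans (p_dvd_lt _ ltR).
rewrite -(card_lcoset [~: V, G] v) subset_leq_card //.
apply/subsetP=> _ /imsetP[g Gg ->]; rewrite mem_lcoset -commgEl.
exact: mem_commg.
Qed.

(** [C] is the preimage in [E] of the centraliser of [K / L]. Describing it by the subgroups it
    contains reduces its invariance to testing the image of [C] under an automorphism. *)
Lemma char_cent_mod E K L :
    K \char E -> L \char E ->
  {C : {group gT} | C \char E &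
     forall H, (H \subset C) = (H \subset E) && ([~: K, H] \subset L)}.
Proof.
move=> chK chL; have [nLE nLK] := (char_norm chL, subset_trans (char_sub chK) (char_norm chL)).
have [C CP]: {C : {group gT} |
    forall H, (H \subset C) = (H \subset E) && ([~: K, H] \subset L)}.
  exists (E :&: coset L @*^-1 'C(K / L))%G => H.
  rewrite subsetI; case sHE: (H \subset E) => //=.
  have nLH := subset_trans sHE nLE.
  by rewrite -sub_quotient_pre // commGC quotient_cents2.
exists C => //; have [sCE sRL] := andP (etrans (esym (CP C)) (subxx C)).
apply/charP; split=> // f injf Ef.
case/charP: (chK) => sKE /(_ f injf Ef) Kf.
case/charP: (chL) => sLE /(_ f injf Ef) Lf.
apply/morphim_fixP => //.
by rewrite CP -{2}Ef morphimS //= -Kf -morphimR // -Lf morphimS.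
Qed.

Lemma expg_Phi G x : prime p -> p.-group G -> x \in G -> x ^+ p \in 'Phi(G).
Proof.
move=> pr_p pG Gx; have nFx := subsetP (normal_norm (Phi_normal G)) x Gx.
apply: coset_idr; rewrite ?groupX // morphX //.
have [_ -> //] := abelemP pr_p (Phi_quotient_abelem pG).
exact: mem_quotient.
Qed.

Lemma Phi_sub_power E T :
    prime p -> p.-group E -> T <| E -> [~: E, E] \subset T ->
    (forall x, x \in E -> x ^+ p \in T) ->
  'Phi(E) \subset T.
Proof.
move=> pr_p pE /andP[_ nTE] sE'T sEpT.
apply: Phi_min pE nTE _; apply/abelemP => //.
split=> [|_ /morphimP[z nTz Ez ->]]; first exact: sub_der1_abelian.
by rewrite -morphX //= coset_id ?sEpT.
Qed.

(** Modulo [L], [X] equals its commutator with [G], which nilpotency allows only for the trivial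
    group. *)
Lemma comm_joing_nil G X L :
    nilpotent G -> X <| G -> L <| G -> L \subset X -> X \subset [~: X, G] <*> L ->
  X \subset L.
Proof.
move=> nilG /andP[sXG nXG] /andP[_ nLG] sLX sXR.
have nLX := subset_trans sXG nLG.
apply: contraT => nsXL; have ntX: X / L != 1 by rewrite -subG1 quotient_sub1.
have nilGL: nilpotent (G / L) by apply: quotient_nil.
have: [~: X / L, G / L] \proper X / L.
  by apply: nil_comm_properl nilGL _ ntX _; rewrite ?quotientS // subsetI subxx quotient_norms.
rewrite properE => /andP[_] /negP[]; rewrite -quotientR //.
rewrite -(quotientYidr (comm_subG nLX nLG)); exact: quotientS.
Qed.

(** The automorphism group of a cyclic group is abelian. *)
Lemma cyclic_der1_cent G K : G \subset 'N(K) -> cyclic K -> [~: G, G] \subset 'C(K).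
Proof.
move=> nKG cycK; have nKG': [~: G, G] \subset 'N(K) by rewrite comm_subG.
rewrite -ker_conj_aut ker_trivg_morphim nKG' morphimR //.
apply/trivgP/commG1P; apply: (sub_abelian_cent2 (Aut_cyclic_abelian cycK));
  exact: Aut_conj_aut.
Qed.

Lemma normal_prime_index_pair G A B :
    prime p -> p.-group G -> A <| G -> B <| G -> #|G : A| = p -> #|G : B| = p ->
    A :!=: B ->
  A * B = G /\ #|A : A :&: B| = p.
Proof.
move=> pr_p pG nsAG nsBG iA iB neAB.
have [sAG sBG] := (normal_sub nsAG, normal_sub nsBG).
have defG: A * B = G.
  apply: (mulg_normal_maximal nsAG) => //.
    by apply: p_index_maximal; rewrite ?iA.
  apply: contra neAB => sBA; rewrite eq_sym eqEcard sBA /=.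
  by rewrite -(leq_pmul2r (prime_gt0 pr_p)) -{1}iA -iB !Lagrange.
split=> //; apply/eqP; rewrite indexgI -(eqn_pmul2r (cardG_gt0 B)) LagrangeMr.
by rewrite defG -iB mulnC Lagrange.
Qed.

(** [E / T] is abelian, so raising to the power [p] is an endomorphism of it; [R] is the preimage of
    its kernel. *)
Lemma char_power_mod E T :
    T \char E -> [~: E, E] \subset T -> 
  {R : {group gT} | R \char E & forall x, (x \in R) = (x \in E) && (x ^+ p \in T)}.
Proof.
move=> chT sET; have nTE := char_norm chT.
have cEE: abelian (E / T) by rewrite /abelian quotient_cents2.
have gR: group_set [set x in E | x ^+ p \in T].
  apply/group_setP; split=> [|x y]; first by rewrite inE !group1 expg1n group1.
  rewrite !inE => /andP[Ex Txp] /andP[Ey Typ]; rewrite groupM //=.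
  have [nTx nTy] := (subsetP nTE x Ex, subsetP nTE y Ey).
  apply: coset_idr; first by rewrite groupX ?groupM.
  rewrite morphX ?groupM // morphM // expgMn; last first.
    by apply: (centsP cEE); rewrite mem_quotient.
  by rewrite -!morphX //= !coset_id ?mulg1.
exists (Group gR) => [|x]; last by rewrite inE.
apply/charP; split=> [|f injf Ef]; first by apply/subsetP=> x; rewrite inE; case/andP.
case/charP: chT => sTE /(_ f injf Ef) Tf.
apply/morphim_fixP => //; first by apply/subsetP=> x; rewrite inE; case/andP.
apply/subsetP=> _ /morphimP[x Ex /[!inE] /andP[_ Txp] ->].
have Efx: f x \in E by have := mem_morphim f Ex Ex; rewrite Ef.
by rewrite Efx -morphX //= -Tf mem_morphim // groupX.
Qed.

(** The derived subgroup is generated by [[~ x, y]], and centrality gives [[~ x, y] ^+ p =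
    [~ x ^+ p, y] = 1]. *)
Lemma card_der1_class2 E x y :
    E :=: <[x]> <*> <[y]> -> [~: E, E] \subset 'C(E) -> x ^+ p \in 'C(E) ->
  #|[~: E, E]| %| p.
Proof.
move=> defE cE'E cxp.
have [Ex Ey]: x \in E /\ y \in E.
  by rewrite defE !mem_gen // inE cycle_id ?orbT.
have cR z : z \in E -> commute z [~ x, y].
  by move=> Ez; apply: commute_sym; apply: (centsP cE'E); rewrite ?mem_commg.
have -> : [~: E, E] = <[ [~ x, y] ]>.
  rewrite -derg1 defE der1_joing_cycles // -defE.
  by rewrite (subsetP cE'E) ?mem_commg.
rewrite order_dvdn -commXg; last exact: cR.
by apply/commgP; apply: (centP cxp).
Qed.

End PGroupLemmas.

(** * p-groups whose Frattini quotient is irreducible under automorphisms *)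

Section CharIrreducible.
Variables (gT : finGroupType) (p : nat).
Implicit Types A C E H N R T U W X Y : {group gT}.

Definition char_irreducible E :=
  forall X, X \char E -> 'Phi(E) \subset X -> X :=: 'Phi(E) \/ X :=: E.

(* The action of E on K / W, which has order at most p ^ 2, has kernel of index
   at most p, so by irreducibility the kernel is E. *)
Lemma comm_Phi_sub E W :
    prime p -> p.-group E -> #|E : 'Phi(E)| = (p ^ 2)%N -> char_irreducible E ->
    W \char E -> W \subset 'Phi(E) -> #|'Phi(E) : W| <= p ^ 2 ->
    'Phi('Phi(E)) \subset W ->
  [~: 'Phi(E), E] \subset W.
Proof.
move=> pr_p pE iE irrE chW sWK iKW sLW.
have [nsWE nsKE] := (char_normal chW, Phi_normal E).
have nWE := normal_norm nsWE.
have nWK := subset_trans (Phi_sub E) nWE.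
have cKK: [~: 'Phi(E), 'Phi(E)] \subset W.
  rewrite -derg1 (subset_trans _ sLW) //.
  by rewrite (Phi_joing (pgroupS (Phi_sub E) pE)) joing_subl.
have [C chC defC] := char_cent_mod (Phi_char E) chW.
have [] := irrE C chC; first by rewrite defC Phi_sub.
  move=> CK; pose CQ := ('C_(E / W)('Phi(E) / W))%G.
  have sCQ: CQ \subset 'Phi(E) / W.
    rewrite -CK -(cosetpreK CQ) quotientS //=.
    have nWC: coset W @*^-1 CQ \subset 'N(W) by apply: subsetIl.
    have sCE: coset W @*^-1 CQ \subset E.
      rewrite -(quotientGK nsWE) cosetpreSK; exact: subsetIl.
    rewrite defC sCE /= -quotient_cents2 // centsC cosetpreK.
    exact: subsetIr.
  have := @index_cent_card_le_p2 _ p (E / W)%G ('Phi(E) / W)%G pr_p (quotient_pgroup W pE).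
  rewrite quotient_normal // card_quotient //= => /(_ isT iKW) le_p.
  have: #|E / W : 'Phi(E) / W| <= p.
    by apply: leq_trans le_p; rewrite dvdn_leq ?indexgS.
  rewrite index_quotient_eq ?Phi_sub //; last by rewrite subIset // sWK orbT.
  by rewrite iE leqNgt -{1}(expn1 p) ltn_exp2l ?prime_gt1.
by move=> CE; have := subxx C; rewrite defC CE => /andP[].
Qed.

(** Let [T] be the right-hand side and [R] the group of elements of [E] with p-th power in [T].
    Modulo [T], [[~ e, n] ^+ p] is [[~ e ^+ p, n]], which lies in [U], so [R] contains [[~: E, N]].
    Irreducibility forces [R] to be [E], and [E / T] is elementary abelian. *)
Lemma Phi_sub_der1_joing E N U :
    prime p -> p.-group E -> char_irreducible E ->
    E <| N -> ~~ ([~: E, N] \subset 'Phi(E)) ->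
    U \char E -> 'Phi('Phi(E)) \subset U -> [~: 'Phi(E), N] \subset U ->
  'Phi(E) \subset [~: E, E] <*> U.
Proof.
move=> pr_p pE irrE nsEN ncEN chU sLU cKN; have nEN := normal_norm nsEN.
pose T := ([~: E, E] <*> U)%G.
have chT: T \char E by rewrite charY // charR ?char_refl.
have sE'T: [~: E, E] \subset T by apply: joing_subl.
have sUT: U \subset T by apply: joing_subr.
have nTE := char_norm chT.
have [R chR defR] := char_power_mod p chT sE'T.
have cTT: abelian (E / T) by apply: sub_der1_abelian.
have [] := irrE R chR.
- apply/subsetP=> z Kz; rewrite defR (subsetP (Phi_sub E)) //.
  apply/(subsetP sUT)/(subsetP sLU).
  exact: expg_Phi (pgroupS (Phi_sub E) pE) Kz.
- move=> RK; case/negP: ncEN; rewrite -RK gen_subG.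
  apply/subsetP=> _ /imset2P[e n Ee Nn ->].
  have Een: e ^ n \in E by rewrite memJ_norm // (subsetP nEN).
  rewrite defR commgEl groupM ?groupV //=.
  have [nTe nTen] := (subsetP nTE e Ee, subsetP nTE _ Een).
  have TR: [~ e ^+ p, n] \in T.
    apply/(subsetP sUT)/(subsetP cKN)/mem_commg => //.
    exact: expg_Phi.
  have nTeV: e^-1 \in 'N(T) by rewrite groupV.
  apply: coset_idr; first exact: groupX (groupM nTeV nTen).
  rewrite morphX ?(groupM nTeV nTen) // morphM // expgMn; last first.
    by apply: (centsP cTT); rewrite mem_quotient ?groupV.
  rewrite -!morphX // -morphM ?(groupX p nTeV) ?(groupX p nTen) //= expVgn -conjXg.
  by rewrite -commgEl coset_id.
move=> RE; apply: (Phi_sub_power pr_p pE (char_normal chT) sE'T) => z Ez.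
have /andP[_ //]: (z \in E) && (z ^+ p \in T) by rewrite -defR RE.
Qed.

(** In [E / U] the image of ['Phi(E)] is central and, by the preceding inclusion, equals the derived
    subgroup, which two generators make cyclic of order dividing [p]. *)
Lemma index_Phi_dvd E N U x y :
    prime p -> p.-group E -> E :=: <[x]> <*> <[y]> -> char_irreducible E ->
    E <| N -> ~~ ([~: E, N] \subset 'Phi(E)) ->
    U \char E -> 'Phi('Phi(E)) \subset U -> U \subset 'Phi(E) ->
    [~: 'Phi(E), N] \subset U ->
  #|'Phi(E) : U| %| p.
Proof.
move=> pr_p pE defE irrE nsEN ncEN chU sLU sUK cKN.
have sKJ := Phi_sub_der1_joing pr_p pE irrE nsEN ncEN chU sLU cKN.
have nUE := char_norm chU; have sEN := normal_sub nsEN.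
have sKE := Phi_sub E; have nUK := subset_trans sKE nUE.
have cKE: 'Phi(E) / U \subset 'C(E / U).
  by rewrite quotient_cents2 // (subset_trans _ cKN) // commgS.
have [Ex Ey]: x \in E /\ y \in E.
  by rewrite defE !mem_gen // inE cycle_id ?orbT.
have [nUx nUy] := (subsetP nUE x Ex, subsetP nUE y Ey).
have sE'K: [~: E, E] \subset 'Phi(E) by rewrite (Phi_joing pE) joing_subl.
have defK: 'Phi(E) / U = [~: E / U, E / U].
  rewrite -quotientR //; apply/eqP; rewrite eqEsubset (quotientS U sE'K) andbT.
  rewrite -(quotientYidr (subset_trans sE'K nUK)) quotientS //.
rewrite -card_quotient // defK.
apply: (@card_der1_class2 _ p (E / U)%G (coset U x) (coset U y)).
- by rewrite /= defE quotientY ?cycle_subG // !quotient_cycle.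
- by rewrite -quotientR // (subset_trans _ cKE) ?quotientS.
by rewrite -morphX //= (subsetP cKE) // mem_quotient // expg_Phi.
Qed.

(** Suppose the two differ, and let [R] be the group of elements of [E1] with p-th power in [T]. If
    [R] is [E1], then ['Phi(E1)] lies in [T], hence in ['Phi(E2)], and orders agree. If [R] is
    ['Phi(E1)], then [E1 / T] is homocyclic of exponent [p ^ 2], and a p-th power computation puts
    [[~: E1, N]] inside [R]. *)
Lemma Phi_eq_of_prime_index N E1 E2 :
    prime p -> odd p -> p.-group N -> E1 <| N -> E2 <| N ->
    #|N : E1| = p -> #|N : E2| = p -> E1 :!=: E2 ->
    #|E1 : 'Phi(E1)| = (p ^ 2)%N -> #|E2 : 'Phi(E2)| = (p ^ 2)%N ->
    char_irreducible E1 -> ~~ ([~: E1, N] \subset 'Phi(E1)) ->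
  'Phi(E1) = 'Phi(E2).
Proof.
move=> pr_p odd_p pN nsE1 nsE2 iE1 iE2 neE iK1 iK2 irrE1 ncE1.
have [sE1 sE2] := (normal_sub nsE1, normal_sub nsE2).
have [pE1 pE2] := (pgroupS sE1 pN, pgroupS sE2 pN).
have sPhi A : A <| N -> #|N : A| = p -> 'Phi(N) \subset A.
  by move=> nsA iA; rewrite Phi_sub_max // p_index_maximal ?normal_sub ?iA.
have [_ iF1] := normal_prime_index_pair pr_p pN nsE1 nsE2 iE1 iE2 neE.
have neE2 : E2 :!=: E1 by rewrite eq_sym.
have [_ iF2] := normal_prime_index_pair pr_p pN nsE2 nsE1 iE2 iE1 neE2.
rewrite setIC in iF2.
set F := (E1 :&: E2)%G; have nsF: F <| N by apply: normalI.
have sPhiF: 'Phi(N) \subset F by rewrite subsetI !sPhi.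
have sN'F: [~: N, N] \subset F.
  by rewrite (subset_trans _ sPhiF) // (Phi_joing pN) joing_subl.
have sKF A : A <| N -> 'Phi(A) \subset F.
  by move=> nsA; rewrite (subset_trans _ sPhiF) // (PhiS pN) ?normal_sub.
have [sK1 sK2] := (sKF _ nsE1, sKF _ nsE2).
have iFK A : #|A : F| = p -> F \subset A -> 'Phi(A) \subset F ->
    #|A : 'Phi(A)| = (p ^ 2)%N -> #|F : 'Phi(A)| = p.
  move=> iAF sFA sK iA; apply/eqP; rewrite -(eqn_pmul2l (prime_gt0 pr_p)).
  by rewrite -{1}iAF mulnn -iA Lagrange_index.
have jK1 := iFK E1 iF1 (subsetIl _ _) sK1 iK1.
have jK2 := iFK E2 iF2 (subsetIr _ _) sK2 iK2.
have nsK1 := char_normal_trans (Phi_char E1) nsE1.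
have nsK2 := char_normal_trans (Phi_char E2) nsE2.
apply/eqP; apply: contraT => neK.
have pF := pgroupS (normal_sub nsF) pN.
have [nsK1F nsK2F] := (normalS sK1 (normal_sub nsF) nsK1, normalS sK2 (normal_sub nsF) nsK2).
have [_ iI] := normal_prime_index_pair pr_p pF nsK1F nsK2F jK1 jK2 neK.
set I := ('Phi(E1) :&: 'Phi(E2))%G.
have nsI: I <| N by apply: normalI.
have cFN: [~: F, N] \subset I.
  by rewrite subsetI !(@comm_sub_prime_index _ p).
have sIK1: I \subset 'Phi(E1) by apply: subsetIl.
have sE1'K: [~: E1, E1] \subset 'Phi(E1) by rewrite (Phi_joing pE1) joing_subl.
(* [F / I] is central in [E1 / I] with quotient of order [p], so [E1 / I] is abelian. *)
have sE1'I: [~: E1, E1] \subset I.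
  have nIE1 := subset_trans sE1 (normal_norm nsI).
  have sFE1: F \subset E1 by apply: subsetIl.
  apply: (der1_min nIE1); apply: (@cyclic_factor_abelian _ (F / I)%G).
    rewrite subsetI quotientS // quotient_cents2 ?(subset_trans sFE1 nIE1) //.
    by rewrite (subset_trans _ cFN) // commgS.
  apply: prime_cyclic; rewrite card_quotient; last first.
    by rewrite quotient_norms // (subset_trans sE1) ?normal_norm.
  by rewrite index_quotient_eq ?iF1 // subIset // (subset_trans sIK1) ?orbT.
pose T := ([~: E1, E1] <*> 'Phi('Phi(E1)))%G.
have sTK1: T \subset 'Phi(E1) by rewrite join_subG sE1'K Phi_sub.
have sTI: T \subset I.
  rewrite subsetI sTK1 join_subG (subset_trans sE1'I) ?subsetIr //=.
  by rewrite (PhiS pE2) // (subset_trans sK1) ?subsetIr.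
have chT: T \char E1.
  by rewrite charY ?charR ?char_refl // (char_trans (Phi_char _)) ?Phi_char.
have sE1'T: [~: E1, E1] \subset T by apply: joing_subl.
have nTE1 := char_norm chT.
have [R chR defR] := char_power_mod p chT sE1'T.
have pK1 := pgroupS (Phi_sub E1) pE1.
have [] := irrE1 R chR.
- apply/subsetP=> z Kz; rewrite defR (subsetP (Phi_sub E1)) //=.
  by apply: (subsetP (joing_subr _ _)); apply: expg_Phi.
- move=> defRK; case/negP: ncE1.
  have cTT: abelian (E1 / T) by apply: sub_der1_abelian.
  (* In the abelian group [E1 / T], the image of ['Phi(E1)] is both the group of p-th powers and the
     kernel of the p-th power map, so its order equals its index. *)
  have iKT: #|'Phi(E1) : T| = (p ^ 2)%N.
    have nTK1 := subset_trans (Phi_sub E1) nTE1.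
    have pET: p.-group (E1 / T) by apply: quotient_pgroup.
    have defM: 'Mho^1(E1 / T) = 'Phi(E1) / T.
      by rewrite -(Phi_Mho pET cTT) -(quotient_Phi pE1).
    have defO: 'Ohm_1(E1 / T) = 'Phi(E1) / T.
      rewrite (OhmEabelian pET) ?(abelianS (Ohm_sub _ _)) //.
      apply/setP=> z; rewrite !inE expn1.
      apply/andP/idP=> [[/morphimP[e nTe Ee ->{z}] /eqP]|].
        rewrite -morphX //= => /coset_idr Tep.
        have Ke: e \in 'Phi(E1) by rewrite -defRK defR Ee Tep ?groupX.
        exact: mem_quotient.
      case/morphimP=> e nTe; rewrite -defRK defR => /andP[Ee Tep] ->.
      by rewrite mem_quotient // -morphX //= coset_id.
    have:= mul_card_Ohm_Mho_abelian 1 cTT; rewrite defM defO.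
    rewrite !card_quotient // -(Lagrange_index (Phi_sub E1) sTK1) iK1.
    by move/eqP; rewrite /= eqn_pmul2r ?indexg_gt0 // => /eqP.
  have iIT: #|I : T| = p.
    apply/eqP; rewrite -(eqn_pmul2l (prime_gt0 pr_p)) -{1}iI.
    by rewrite Lagrange_index // iKT mulnn.
  have nsT := char_normal_trans chT nsE1.
  have cIN: [~: I, N] \subset T by apply: comm_sub_prime_index pN _ _ _ iIT.
  have nTN := normal_norm nsT.
  rewrite commGC gen_subG; apply/subsetP=> _ /imset2P[n e Nn Ee ->].
  have Ne := subsetP sE1 e Ee.
  have Fne: [~ n, e] \in F by apply: (subsetP sN'F); apply: mem_commg.
  have Iz: [~ [~ n, e], n] \in I by apply: (subsetP cFN); apply: mem_commg.
  suff: [~ n, e] \in R by rewrite defRK.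
  rewrite defR (subsetP (subsetIl E1 E2)) //=.
  have [nTn nTe] := (subsetP nTN n Nn, subsetP nTN e Ne).
  have nTy : [~ n, e] \in 'N(T) by rewrite groupR.
  have nTz : [~ [~ n, e], n] \in 'N(T) by rewrite groupR.
  have E1np: n ^+ p \in E1.
    by apply: (subsetP (sPhi _ nsE1 iE1)); apply: expg_Phi.
  have czN g : g \in N -> commute (coset T g) (coset T [~ [~ n, e], n]).
    move=> Ng; apply: commute_sym.
    by apply: (centsP (quotient_cents2r cIN)); rewrite mem_quotient.
  have zp: coset T [~ [~ n, e], n] ^+ p = 1.
    rewrite -morphX //= coset_id //.
    have: [~ [~ n, e], n] \in R by rewrite defRK (subsetP sIK1).
    by rewrite defR => /andP[].
  have Nne: [~ n, e] \in N by apply: groupR.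
  (* Modulo T, n ^ p = (n ^ e) ^ p = (n [n, e]) ^ p = n ^ p [n, e] ^ p. *)
  have := @expMg_Rmul _ p (coset T [~ n, e]) (coset T n).
  rewrite -morphR // => /(_ (czN _ Nne) (czN _ Nn)).
  (* The cross term [[~ [~ n, e], n]] has order dividing [p] modulo [T], and its exponent ['C(p, 2)]
     is a multiple of [p] because [p] is odd. *)
  have /dvdnP[k ->] : p %| 'C(p, 2).
    rewrite prime_dvd_bin //=; have := prime_gt1 pr_p; rewrite leq_eqVlt.
    by case/predU1P=> // p2; rewrite -p2 in odd_p.
  rewrite mulnC expgM zp expg1n mulg1 -morphM // -!morphX ?(groupM nTn nTy) //.
  rewrite -conjg_mulR -conjXg morphJ ?(groupX p nTn) //.
  have -> : coset T (n ^+ p) ^ coset T e = coset T (n ^+ p).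
    apply/conjg_fixP/commgP; apply: (centsP cTT); rewrite mem_quotient //.
  rewrite /= => /esym/(canRL (mulKg _)); rewrite mulVg.
  by move/coset_idr; apply; apply: groupX.
move=> defRE; apply: contraTT isT => _.
have sK1T: 'Phi(E1) \subset T.
  apply: (Phi_sub_power pr_p pE1 (char_normal chT) sE1'T) => z Ez.
  by have /andP[]: (z \in E1) && (z ^+ p \in T) by rewrite -defR defRE.
case/negP: neK; rewrite eqEcard (subset_trans sK1T) ?(subset_trans sTI) ?subsetIr //=.
by rewrite -(leq_pmul2r (prime_gt0 pr_p)) -{1}jK2 -jK1 !Lagrange.
Qed.

(** * A maximal subgroup [E] of [N] and its image [E2] under an automorphism of [N] *)

Section TwoMaximals.

Variables (N E E2 : {group gT}) (f : {morphism N >-> gT}) (x y : gT).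
Hypotheses (pr_p : prime p) (odd_p : odd p) (pN : p.-group N).
Hypotheses (nsEN : E <| N) (iE : #|N : E| = p).
Hypotheses (iK : #|E : 'Phi(E)| = (p ^ 2)%N) (defE : E :=: <[x]> <*> <[y]>).
Hypotheses (irrE : char_irreducible E).
Hypotheses (ncEN : ~~ ([~: E, N] \subset 'Phi(E))).
Hypotheses (injf : 'injm f) (fN : f @* N = N) (fE : f @* E = E2) (neE : E :!=: E2).

Let K := 'Phi(E)%G.
Let L := 'Phi(K)%G.
Let sEN : E \subset N := normal_sub nsEN.
Let pE : p.-group E := pgroupS sEN pN.
Let sKE : K \subset E := Phi_sub E.
Let sKN : K \subset N := subset_trans sKE sEN.
Let pK : p.-group K := pgroupS sKE pE.
Let sLK : L \subset K := Phi_sub K.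
Let chK : K \char E := Phi_char E.
Let chL : L \char E := char_trans (Phi_char K) chK.
Let nsKN : K <| N := char_normal_trans chK nsEN.
Let nsLN : L <| N := char_normal_trans chL nsEN.

Let nsE2N : E2 <| N.
Proof. by rewrite -fE -[X in _ <| X]fN morphim_normal. Qed.

Let iE2 : #|N : E2| = p.
Proof. by rewrite -fE -[X in #|X : _|]fN index_injm. Qed.

Let fK : f @* K = K.
Proof.
have fK2: f @* K = 'Phi(E2) by rewrite injm_Phi ?fE.
have iK2 : #|E2 : 'Phi(E2)| = (p ^ 2)%N.
  by rewrite -fK2 -fE index_injm.
rewrite fK2; symmetry.
exact: (Phi_eq_of_prime_index pr_p odd_p pN nsEN nsE2N iE iE2 neE).
Qed.

Let fL : f @* L = L.
Proof. by rewrite injm_Phi ?fK. Qed.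

Let defN : E * E2 = N.
Proof. by case: (normal_prime_index_pair pr_p pN nsEN nsE2N iE iE2 neE). Qed.

Let iF : #|E : E :&: E2| = p.
Proof. by case: (normal_prime_index_pair pr_p pN nsEN nsE2N iE iE2 neE). Qed.

Let comm_sub_N (X U : {group gT}) :
    U <| N -> X \subset N ->
    [~: X, E] \subset U -> [~: X, E2] \subset U -> [~: X, N] \subset U.
Proof.
move=> /andP[_ nUN] sXN cXE cXE2.
have [nUX nUE nUE2] := And3 (subset_trans sXN nUN) (subset_trans sEN nUN)
  (subset_trans (normal_sub nsE2N) nUN).
rewrite -quotient_cents2 // -defN quotientMl // centsC mul_subG //.
  by rewrite centsC quotient_cents2.
by rewrite centsC quotient_cents2.
Qed.

Let cKK : [~: K, K] \subset L.
Proof. by have : [~: K, K] \subset 'Phi(K) by rewrite (Phi_joing pK) joing_subl. Qed.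

(** Otherwise [K] is the centraliser of [K / L] in [E], so [E :&: E2], of index [p] in [E], acts
    nontrivially on [K / L]. The group [U], strictly between [L] and [K], and its image [U2] both
    contain [[~: K, E :&: E2]]; each possible pair of indices is excluded. *)
Lemma comm_Phi_sub_Phi : #|K : L| <= p ^ 3 -> [~: K, E] \subset L.
Proof.
move=> iKL; apply: contraT => ncKE.
have [C chC defC] := char_cent_mod chK chL.
have CK: C :=: K.
  have [|//|CE] := irrE chC.
    by rewrite defC sKE.
  by have := subxx C; rewrite defC CE subxx (negbTE ncKE).
have hE H : H \subset E -> [~: K, H] \subset L -> H \subset K.
  by move=> sHE cKH; rewrite -CK defC sHE.
pose U := ([~: K, E] <*> L)%G; pose U2 := (f @* U)%G.
have cKEU : [~: K, E] \subset U by apply: joing_subl.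
have sLU : L \subset U by apply: joing_subr.
have nKE : E \subset 'N(K) := normal_norm (char_normal chK).
have sUK : U \subset K by rewrite join_subG sLK commg_subl nKE.
have sUN := subset_trans sUK sKN.
have chU : U \char E by rewrite charY // charR ?char_refl.
have nsUN : U <| N := char_normal_trans chU nsEN.
have nsU2N : U2 <| N by rewrite -[X in _ <| X]fN morphim_normal.
have sU2K : U2 \subset K by rewrite -fK morphimS.
have sLU2 : L \subset U2 by rewrite -fL morphimS.
have cKE2U2 : [~: K, E2] \subset U2 by rewrite -fK -fE -morphimR // morphimS.
have neUL : ~~ (U \subset L) by apply: contra ncKE; apply: subset_trans.
have nilE := pgroup_nil pE.
have neKU : ~~ (K \subset U).
  apply: contra ncKE => sKU; apply: subset_trans cKEU _; apply: subset_trans sUK _.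
  exact: comm_joing_nil nilE (char_normal chK) (char_normal chL) sLK sKU.
have p_index X Y : X \subset Y -> Y \subset K -> ~~ (Y \subset X) ->
    exists a, #|Y : X| = (p ^ a.+1)%N.
  move=> sXY sYK neXY.
  have [[|a] ia] := p_natP (pnat_dvd (dvdn_indexg Y X) (pgroupS sYK pK)).
    by move/eqP: ia; rewrite indexg_eq1 (negbTE neXY).
  by exists a.
have [a iUL] := p_index L U sLU sUK neUL.
have [b iKU] := p_index U K sUK (subxx K) neKU.
(* The indices are [p ^ a.+1] and [p ^ b.+1], with product at most [p ^ 3]. *)
have le_ab: a + b <= 1.
  move: iKL; rewrite -(Lagrange_index sUK sLU) iUL iKU -expnD.
  by rewrite leq_exp2l ?prime_gt1 // addSn addnS !ltnS addnC.
have iE2U2 : #|K : U2| = #|K : U|.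
  by rewrite -[X in #|X : U2|]fK index_injm.
have ncKF : ~~ ([~: K, E :&: E2] \subset L).
  apply/negP=> /(hE _ (subsetIl E E2)) sFK.
  have := dvdn_leq (indexg_gt0 _ _) (indexgS E sFK).
  by rewrite iK iF leqNgt -{1}(expn1 p) ltn_exp2l ?prime_gt1.
have sRI : [~: K, E :&: E2] \subset U :&: U2.
  by rewrite subsetI (subset_trans _ cKEU) ?(subset_trans _ cKE2U2) ?commgS ?subsetIl ?subsetIr.
have cKN : U :=: U2 -> [~: K, N] \subset U.
  by move=> eqU; apply: comm_sub_N => //; rewrite eqU.
(* First the case where [U] has index [p ^ 2] in [K]: [U] and [U2] have index [p] over [L] and meet
   strictly above it, so they coincide. Then [[~: K, N]] lies in [U], whose index would divide
   [p]. *)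
case: b => [|b] in iKU le_ab; last first.
  have a0 : a = 0 by move: le_ab; rewrite addnS ltnS leqn0 addn_eq0 => /andP[/eqP].
  have b0 : b = 0 by move: le_ab; rewrite addnS ltnS leqn0 addn_eq0 => /andP[_ /eqP].
  rewrite {a}a0 {b}b0 in iUL iKU le_ab.
  have eqU : U :=: U2.
    have sLI : L \subset U :&: U2 by rewrite subsetI sLU.
    have neIL : ~~ (U :&: U2 \subset L) by apply: contra ncKF; apply: subset_trans.
    have maxL : maximal L U by apply: p_index_maximal; rewrite ?iUL.
    have [_ maxLU] := maxgroupP maxL.
    have UI : U :&: U2 = U.
      apply/eqP; rewrite eqEproper subsetIl; apply: contra neIL => ltIU.
      by rewrite (maxLU [group of U :&: U2]).
    apply/eqP; rewrite eqEcard -{1}UI subsetIr /=.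
    by rewrite card_injm.
  have := index_Phi_dvd pr_p pE defE irrE nsEN ncEN chU sLU sUK (cKN eqU).
  rewrite iKU => /(dvdn_leq (prime_gt0 pr_p)).
  by rewrite leqNgt -{1}(expn1 p) ltn_exp2l ?prime_gt1.
rewrite expn1 in iKU.
(* When both indices are [p], [K / L] has order [p ^ 2] and [comm_Phi_sub] applies directly. *)
case: a => [|a] in iUL le_ab; rewrite addn0 in le_ab.
  case/negP: ncKE; apply: (comm_Phi_sub pr_p pE) => //.
  by rewrite -(Lagrange_index sUK sLU) iKU iUL.
have {le_ab} a0 : a = 0 by case: a le_ab {iUL}.
rewrite {a}a0 in iUL.
(* Otherwise [W] has index at most [p ^ 2] in [K], so it contains [[~: K, E]] and hence [U], which
   nilpotency forbids. *)
have cUE : [~: U, E] \subset L.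
  apply: contraT => ncUE; pose W := ([~: U, E] <*> L)%G.
  have chW : W \char E by rewrite charY // charR ?char_refl.
  have sLW : L \subset W by apply: joing_subr.
  have sWU : W \subset U.
    by rewrite join_subG sLU commg_subl (normal_norm (char_normal chU)).
  have neWL : ~~ (W \subset L).
    by apply: contra ncUE; apply: subset_trans; apply: joing_subl.
  have [c iWL] := p_index L W sLW (subset_trans sWU sUK) neWL.
  have iUW : #|U : W| <= p.
    move: iUL; rewrite -(Lagrange_index sWU sLW) iWL => oUW.
    rewrite -(leq_pmul2r (prime_gt0 pr_p)) mulnn -oUW leq_pmul2l ?indexg_gt0 //.
    by rewrite -{1}(expn1 p) leq_exp2l ?prime_gt1.
  have: [~: K, E] \subset W.
    apply: (comm_Phi_sub pr_p pE) => //; first exact: subset_trans sUK.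
    by rewrite -(Lagrange_index sUK sWU) iKU leq_pmul2l ?prime_gt0.
  move=> cKEW; case/negP: neUL.
  apply: (comm_joing_nil nilE (char_normal chU) (char_normal chL) sLU).
  by rewrite join_subG cKEW.
have cU2E2 : [~: U2, E2] \subset L by rewrite -fL -fE -morphimR // morphimS.
(* If [U] is invariant, the three subgroups lemma modulo [L] puts [[~: E, N]] in the centraliser [K]
   of [K / L]. *)
have [eqU | neU] := eqVneq (U : {set gT}) U2.
  have cUN : [~: U, N] \subset L by apply: comm_sub_N => //; rewrite eqU.
  have sEN'E : [~: E, N] \subset E by rewrite commg_subl normal_norm.
  case/negP: ncEN; apply: hE => //=.
  have nLN := normal_norm nsLN.
  have quoR (X Y Z : {group gT}) : X \subset N -> Y \subset N -> Z \subset N ->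
      ([~: X / L, Y / L, Z / L] = 1) <-> ([~: X, Y, Z] \subset L).
    move=> sX sY sZ; have nL (V : {set gT}) : V \subset N -> V \subset 'N(L).
      by move=> sVN; apply: subset_trans sVN nLN.
    have sR := comm_subG sX sY; rewrite -!quotientR ?nL //.
    rewrite -quotient_sub1 ?nL ?(comm_subG sR) //; exact: rwP trivgP.
  rewrite commGC; apply/quoR => //; apply: three_subgroup; apply/quoR => //.
    by rewrite (subset_trans _ cUE) // commSg // commGC cKN.
  by rewrite (subset_trans _ cUN) // commSg.
(* If [U] and [U2] differ, their product is [K], and [E :&: E2] centralises both modulo [L]. *)
case/negP: ncKF.
have nsUK := normalS sUK sKN nsUN; have nsU2K := normalS sU2K sKN nsU2N.
have [defK _] := normal_prime_index_pair pr_p pK nsUK nsU2K iKU (etrans iE2U2 iKU) neU.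
have nLK := normal_norm (Phi_normal K).
have nLF : E :&: E2 \subset 'N(L) by rewrite (subset_trans _ (char_norm chL)) ?subsetIl.
rewrite -quotient_cents2 // -defK quotientMl ?(subset_trans sUK) // mul_subG //.
  rewrite quotient_cents2 ?(subset_trans sUK) //.
  by rewrite (subset_trans _ cUE) ?commgS ?subsetIl.
rewrite quotient_cents2 ?(subset_trans sU2K) //.
by rewrite (subset_trans _ cU2E2) ?commgS ?subsetIr.
Qed.

Lemma pearl_of_moved_maximal :
    #|K : L| <= p ^ 3 ->
  p.-abelem E && (#|E| == p ^ 2)%N \/ ~~ abelian E && (#|E| == p ^ 3)%N.
Proof.
move=> iKL; have cKE := comm_Phi_sub_Phi iKL.
have cKE2 : [~: K, E2] \subset L by rewrite -fK -fL -fE -morphimR // morphimS.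
have cKN : [~: K, N] \subset L by apply: comm_sub_N.
have cycK : cyclic K.
  apply: Phi_quotient_cyclic.
  have := index_Phi_dvd pr_p pE defE irrE nsEN ncEN chL (subxx L) sLK cKN.
  rewrite -card_quotient ?normal_norm ?Phi_normal //.
  case/primeP: (pr_p) => _ dvd_p /dvd_p /pred2P[/eqP | oKL].
    by rewrite -trivg_card1 => /eqP->; apply: cyclic1.
  by rewrite prime_cyclic // oKL.
have sE'K : [~: E, E] \subset K.
  by have : [~: E, E] \subset 'Phi(E) by rewrite (Phi_joing pE) joing_subl.
have defK : [~: E, E] = K.
  rewrite -[LHS]genGid; apply: Phi_nongen.
  apply/eqP; rewrite eqEsubset join_subG sLK sE'K /= joingC.
  exact: (Phi_sub_der1_joing pr_p pE irrE nsEN ncEN chL (subxx L) cKN).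
(* The derived subgroup of [N] centralises the cyclic group [K], so ['C_E(K)] contains [[~: E, N]],
   hence is not [K], and is [E] by irreducibility. *)
have cEK : K \subset 'C(E).
  have cNK := cyclic_der1_cent (normal_norm nsKN) cycK.
  have chC : 'C_E(K) \char E by rewrite subcent_char ?char_refl.
  have [||CE] := irrE chC.
  - by rewrite subsetI sKE -[_ \subset _]/(abelian K) cyclic_abelian.
  - move=> CK; case/negP: ncEN; rewrite -CK subsetI commg_subl normal_norm //=.
    by rewrite (subset_trans _ cNK) ?commSg.
  by rewrite centsC -CE subsetIr.
have oK : #|K| %| p.
  rewrite -defK; apply: (card_der1_class2 defE); first by rewrite defK.
  have Ex : x \in E by rewrite defE mem_gen // inE cycle_id.
  by apply: (subsetP cEK); apply: expg_Phi.
have oE : #|E| = (#|K| * p ^ 2)%N by rewrite -iK Lagrange.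
case/primeP: (pr_p) => _ dvd_p; case/pred2P: (dvd_p _ oK) => oK1.
  left; rewrite oE oK1 mul1n eqxx andbT -(trivg_Phi pE) -/K.
  by rewrite trivg_card1 oK1.
right; rewrite oE oK1 -expnS eqxx andbT; apply/negP=> /derG1P.
rewrite derg1 defK => K1; move: (prime_gt1 pr_p); rewrite -oK1.
by rewrite cardG_gt1 /= K1 eqxx.
Qed.

End TwoMaximals.

End CharIrreducible.

(** * Strongly p-embedded subgroups and normal p-subgroups *)

(** An element of [G] normalising a nontrivial p-subgroup of [M] lies in [M]. Hence a Sylow
    p-subgroup of [M] is one of [G] and contains [Q]; were [Q] nontrivial, its normaliser [G] would
    lie in [M]. *)
Lemma strongly_p_embedded_pcore (rT : finGroupType) (p : nat) (G M Q : {group rT}) :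
    prime p -> strongly_p_embedded p G M -> Q <| G -> p.-group Q -> Q :=: 1.
Proof.
move=> pr_p [/andP[sMG nsGM] pM embM] /andP[sQG nQG] pQ.
have [P sylP] := Sylow_exists p M; have [sPM pP _] := and3P sylP.
have ntP : P :!=: 1.
  rewrite -cardG_gt1 (card_Hall sylP) p_part_gt1 mem_primes pr_p pM cardG_gt0 //.
have mem_M (R : {group rT}) x : x \in G -> R :!=: 1 -> p.-group R ->
    R \subset M -> x \in 'N(R) -> x \in M.
  move=> Gx ntR pR sRM nRx; apply: contraT => notMx.
  have [_ p_dv_R _] := pgroup_pdiv pR ntR.
  case/negP: (embM x Gx notMx); apply: dvdn_trans p_dv_R (cardSg _).
  by rewrite subsetI sRM -{1}(normP nRx) conjSg.
have [P1 sylP1 sPP1] := Sylow_superset (subset_trans sPM sMG) pP.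
have [sP1G pP1 _] := and3P sylP1.
have eqP1 : P1 :=: P.
  apply: (nilpotent_sub_norm (pgroup_nil pP1) sPP1).
  have sNM : 'N_P1(P) \subset M.
    apply/subsetP=> x /setIP[P1x nPx].
    exact: mem_M (subsetP sP1G x P1x) ntP pP sPM nPx.
  rewrite (sub_pHall sylP (pgroupS (subsetIl _ _) pP1) _ sNM) //.
  by rewrite subsetI sPP1 normG.
have sQM : Q \subset M.
  rewrite (subset_trans _ sPM) // -eqP1.
  apply: subset_trans (pcore_sub_Hall sylP1).
  by rewrite pcore_max // /normal sQG.
apply/eqP; apply: contraNT nsGM => ntQ; apply/subsetP=> x Gx.
exact: mem_M Gx ntQ pQ sQM (subsetP nQG x Gx).
Qed.

(** * Automorphisms stabilising a chain of characteristic subgroups *)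

Section AutStab.
Variable gT : finGroupType.
Implicit Types E X Y Z : {group gT}.

Lemma Aut_charP E X a x : X \char E -> a \in Aut E -> x \in X -> a x \in X.
Proof.
case/andP=> _ /forall_inP chX Aa Xx.
exact: (subsetP (chX a Aa)) (imset_f _ Xx).
Qed.

Lemma AutM E a x y : a \in Aut E -> x \in E -> y \in E -> a (x * y) = a x * a y.
Proof. by move=> Aa Ex Ey; rewrite -!(autmE Aa) morphM. Qed.

Lemma AutV E a x : a \in Aut E -> x \in E -> a x^-1 = (a x)^-1.
Proof. by move=> Aa Ex; rewrite -!(autmE Aa) morphV. Qed.

(** The element [y^-1 * a y] is the commutator of [y] and [a] in the holomorph. *)
Definition aut_stab (A : {set {perm gT}}) (Y Z : {set gT}) :=
  [set a in A | [forall y in Y, y^-1 * a y \in Z]].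

Lemma aut_stabP (A : {set {perm gT}}) (Y Z : {set gT}) a :
  reflect (a \in A /\ forall y, y \in Y -> y^-1 * a y \in Z) (a \in aut_stab A Y Z).
Proof. by rewrite inE; apply: (iffP andP) => -[Aa /forall_inP]. Qed.

Variables (A : {group {perm gT}}) (E Y Z : {group gT}).
Hypotheses (sAE : A \subset Aut E) (chY : Y \char E) (chZ : Z \char E).

Lemma aut_stab_group_set : group_set (aut_stab A Y Z).
Proof.
apply/group_setP; split=> [|a b].
  by apply/aut_stabP; split=> // y Yy; rewrite perm1 mulVg.
case/aut_stabP=> Aa Sa /aut_stabP[Ab Sb]; apply/aut_stabP.
split=> [|y Yy]; first exact: groupM.
have Yay := Aut_charP chY (subsetP sAE a Aa) Yy.
by rewrite permM -(mulKVg (a y) (b _)) mulgA groupM ?Sa ?Sb.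
Qed.

Lemma aut_stab_norm : A \subset 'N(aut_stab A Y Z).
Proof.
apply/subsetP=> c Ac; rewrite inE; apply/subsetP=> _ /imsetP[a Sa ->].
have [Aa Sya] := aut_stabP _ _ _ _ Sa; apply/aut_stabP.
split=> [|y Yy]; first exact: groupJ.
have AEc := subsetP sAE c Ac.
have Yw := Aut_charP chY (groupVr AEc) Yy.
have Ew := subsetP (char_sub chY) _ Yw.
have Eaw := subsetP (char_sub chY) _ (Aut_charP chY (subsetP sAE a Aa) Yw).
rewrite conjgE !permM -{1}(permKV c y) -(AutV AEc) // -(AutM AEc) ?groupV //.
by apply: Aut_charP AEc _ => //; apply: Sya.
Qed.

(** The cyclic group of [a] acts on a coset of p-power size, and the number of fixed points is
    congruent to that size modulo [q], hence nonzero. *)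
Lemma Aut_prime_fix_coset (q p : nat) a e :
    a \in Aut E -> #[a] = q -> prime q -> q != p -> p.-group Z ->
    (forall w, w \in e *: Z -> w^-1 * a w \in Z) ->
  exists2 z, z \in Z & a (e * z) = e * z.
Proof.
move=> Aa oa pr_q neqp pZ stZ.
have qa : q.-group <[a]> by rewrite -oa /pgroup -orderE oa pnat_id.
have acts_a : [acts <[a]>, on e *: Z | 'P].
  rewrite cycle_subG !inE /=; apply/subsetP=> w Zw; rewrite inE /= apermE.
  rewrite -(mulKVg w (a w)); have Zs := stZ w Zw; move: Zw; rewrite !mem_lcoset mulgA.
  by move=> Zw; rewrite groupM.
have := pgroup_fix_mod qa acts_a; rewrite card_lcoset => eq_fix.
have /card_gt0P[w] : 0 < #|'Fix_(e *: Z | 'P)(<[a]>)|.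
  rewrite lt0n; apply/eqP=> fix0; move: eq_fix; rewrite fix0 mod0n => /eqP.
  rewrite -/(dvdn q #|Z|) => q_dv_Z.
  by by have := pgroupP pZ q pr_q q_dv_Z; rewrite inE (negbTE neqp).
case/setIP=> /lcosetP[z Zz ->] /afixP/(_ a (cycle_id a)) /=; rewrite apermE.
by exists z.
Qed.

End AutStab.

Section StabPGroup.
Variables (gT : finGroupType) (p : nat).
Variables (A : {group {perm gT}}) (E X : {group gT}).
Hypotheses (sAE : A \subset Aut E) (chX : X \char E) (pE : p.-group E).
Hypothesis (sPhiX : 'Phi(E) \subset X).

(** These automorphisms act trivially on [E / X] and on [X / 'Phi(E)]; the proof terms [char_refl E]
    and [chX] determine the upper groups [E] and [X]. *)
Definition chain_stab : {group {perm gT}} :=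
  (Group (aut_stab_group_set X sAE (char_refl E)) :&:
   Group (aut_stab_group_set 'Phi(E) sAE chX))%G.

Lemma chain_stab_normal : chain_stab <| A.
Proof.
apply/andP; split.
  by apply/subsetP=> a /setIP[/aut_stabP[]].
apply: normsI; first exact: aut_stab_norm sAE (char_refl E) chX.
exact: aut_stab_norm sAE chX (Phi_char E).
Qed.

(* An automorphism of prime order q <> p in the stabiliser fixes a point in
   every coset of X in E and of Phi(E) in X, so its fixed points generate E. *)
Lemma chain_stab_pgroup : p.-group chain_stab.
Proof.
apply/pgroupP=> q pr_q /(Cauchy pr_q)[a Sa oa].
rewrite inE; apply: contraT => neqp.
have [/aut_stabP[Aa SE] /aut_stabP[_ SX]] := setIP Sa.
have AEa := subsetP sAE a Aa; have sXE := char_sub chX.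
have gC : group_set [set e in E | a e == e].
  apply/group_setP; split=> [|u v]; first by rewrite inE group1 -(autmE AEa) morph1 eqxx.
  rewrite !inE => /andP[Eu /eqP au] /andP[Ev /eqP av].
  by rewrite groupM //= (AutM AEa) // au av.
pose C := Group gC; have sCE : C \subset E by apply/subsetP=> e; rewrite inE => /andP[].
have CX : E \subset C * X.
  apply/subsetP=> e Ee; have [w /lcosetP[z Xz ->] //|z Xz fix_ez] :=
    Aut_prime_fix_coset AEa oa pr_q neqp (pgroupS sXE pE) (_ : forall w, w \in e *: X -> _).
    by apply: SE; rewrite groupM // (subsetP sXE).
  rewrite -(mulgK z e) mem_mulg ?groupV // inE fix_ez eqxx andbT.
  by rewrite groupM // (subsetP sXE).
have CPhi : X \subset C * 'Phi(E).
  apply/subsetP=> e Xe; have [w /lcosetP[z Pz ->] //|z Pz fix_ez] :=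
    Aut_prime_fix_coset AEa oa pr_q neqp (pgroupS (Phi_sub E) pE)
      (_ : forall w, w \in e *: 'Phi(E) -> _).
    by apply: SX; rewrite groupM // (subsetP sPhiX).
  rewrite -(mulgK z e) mem_mulg ?groupV // inE fix_ez eqxx andbT.
  by rewrite (subsetP sXE) // groupM // (subsetP sPhiX).
have defC : C :=: E.
  rewrite -[LHS]genGid; apply: Phi_nongen; apply/eqP.
  rewrite eqEsubset join_subG Phi_sub sCE joingC (subset_trans CX) //.
  by rewrite mul_subG ?joing_subl // (subset_trans CPhi) // mulG_subG ?joing_subl ?joing_subr.
have a1 : a = 1.
  apply: (eq_Aut AEa (group1 _)) => e Ee; rewrite perm1.
  by move: Ee; rewrite -defC inE => /andP[_ /eqP].
by move: (prime_gt1 pr_q); rewrite -oa a1 order1.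
Qed.

End StabPGroup.

(** * Essential subgroups of rank two and their normalisers *)

Section EssentialRankTwo.
Variables (gT : finGroupType) (p : nat) (S : {group gT}).
Variables (homF : {set gT} -> {set {ffun gT -> gT}}) (E : {group gT}).
Hypotheses (pr_p : prime p) (pS : p.-group S).
Hypotheses (fusF : fusion_system S homF) (sES : E \subset S).

Lemma pval_conj_aut s : s \in 'N(E) -> pval (conj_aut E s) = cmap E s.
Proof.
move=> nEs; apply/ffunP=> x; rewrite ffunE pvalE.
case: ifPn => [Ex|notEx]; first exact: norm_conj_autE.
by rewrite (@out_Aut _ E) // (subsetP (Aut_conj_aut E 'N(E))) // mem_morphim.
Qed.

Lemma AutF_group_set : group_set (AutF homF E).
Proof.
have [_ homS _ homM] := fusF.
have AutFE a : (a \in AutF homF E) = (a \in Aut E) && (pval a \in homF E).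
  by rewrite inE.
apply/group_setP; split=> [|a b]; rewrite !AutFE.
  rewrite group1 /= (_ : pval 1 = cmap E 1) ?homS //.
  by apply/ffunP=> x; rewrite ffunE pvalE perm1 conjg1 if_same.
case/andP=> Aa homa /andP[Ab homb]; rewrite groupM //=.
rewrite (_ : pval (a * b) = fcomp E (pval a) (pval b)); last first.
  apply/ffunP=> x; rewrite ffunE !pvalE permM.
  by case: ifPn => // notEx; rewrite (out_Aut Aa notEx) (out_Aut Ab notEx).
apply: homM (homa) (homb) _; apply/subsetP=> _ /imsetP[x Ex ->].
by rewrite pvalE -(autmE Aa) -{2}(im_autm Aa) mem_morphim.
Qed.

Let A := Group AutF_group_set.

Lemma AutF_sub_Aut : AutF homF E \subset Aut E.
Proof. by apply/subsetP=> a; rewrite inE => /andP[]. Qed.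

Lemma conj_aut_AutF s : s \in 'N_S(E) -> conj_aut E s \in AutF homF E.
Proof.
have [_ homS _ _] := fusF => /setIP[Ss nEs].
rewrite inE pval_conj_aut // homS // andbT.
by rewrite (subsetP (Aut_conj_aut E 'N(E))) // mem_morphim.
Qed.

Lemma Inn_conj_aut : Inn E = (conj_aut E @* E)%G.
Proof.
apply: val_inj; rewrite /= -[RHS]genGid; congr (<<_>>).
apply/setP=> a; rewrite inE; apply/andP/morphimP=> [[Aa] | [x nEx Ex ->]].
  case/exists_inP=> x Ex /eqP ax; have nEx := subsetP (normG E) x Ex.
  exists x => //; apply/permP=> y.
  by rewrite -!pvalE ax pval_conj_aut.
split; first by rewrite (subsetP (Aut_conj_aut E 'N(E))) // mem_morphim.
by apply/exists_inP; exists x; rewrite // pval_conj_aut.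
Qed.

(** An automorphism [a] turns conjugation by [x] into conjugation by [a x]. *)
Lemma Aut_norm_Inn : Aut E \subset 'N(Inn E).
Proof.
apply/subsetP=> a Aa; rewrite inE Inn_conj_aut /=.
apply/subsetP=> _ /imsetP[_ /morphimP[x nEx Ex ->] ->].
have Eax : a x \in E by apply: Aut_charP Aa Ex; apply: char_refl.
have -> : conj_aut E x ^ a = conj_aut E (a x).
  have Ac y : y \in E -> conj_aut E y \in Aut E.
    by move=> Ey; rewrite (subsetP (Aut_conj_aut E E)) // mem_morphim // (subsetP (normG E)).
  apply: (eq_Aut (groupJ (Ac x Ex) Aa) (Ac _ Eax)) => y Ey.
  have Ew : a^-1 y \in E by apply: Aut_charP (groupVr Aa) Ey; apply: char_refl.
  rewrite conjgE !permM !conj_autE // -{2}(permKV a y).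
  by rewrite !conjgE !(AutM Aa) ?groupM ?groupV // (AutV Aa).
by rewrite mem_morphim // (subsetP (normG E)).
Qed.

Variable M : {group coset_of (Inn E)}.
Hypothesis embM : strongly_p_embedded p (OutF homF E) M.
Hypothesis cSE : 'C_S(E) \subset E.

Let pE : p.-group E := pgroupS sES pS.

(** The automorphisms induced by [H] lie in the chain stabiliser, a normal p-subgroup of
    [AutF homF E] with trivial image in [OutF homF E]. So each element of [H] acts on [E] as an
    element of [E], and differs from it by an element of ['C_S(E)], which lies in [E]. *)
Lemma stab_chain_sub (X H : {group gT}) :
    X \char E -> 'Phi(E) \subset X -> H \subset 'N_S(E) ->
    [~: E, H] \subset X -> [~: X, H] \subset 'Phi(E) ->
  H \subset E.
Proof.
move=> chX sPhiX sHN cEH cXH; have sAE : A \subset Aut E := AutF_sub_Aut.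
pose B := chain_stab sAE chX.
have BI : B \subset Inn E.
  have nsBA : B <| A := chain_stab_normal sAE chX.
  have nIA := subset_trans sAE Aut_norm_Inn.
  have nIB := subset_trans (normal_sub nsBA) nIA.
  rewrite -quotient_sub1 //.
  rewrite (@strongly_p_embedded_pcore _ p (A / Inn E)%G M (B / Inn E)%G) //.
    exact: quotient_normal.
  exact: quotient_pgroup (chain_stab_pgroup sAE chX pE sPhiX).
apply/subsetP=> h Hh; have Nh := subsetP sHN h Hh; have [Sh nEh] := setIP Nh.
have sXE := char_sub chX.
have Bh : conj_aut E h \in B.
  apply/setIP; split; apply/aut_stabP; split; rewrite ?conj_aut_AutF // => y Yy.
    rewrite norm_conj_autE // -commgEl (subsetP cEH) ?mem_commg //.
  by rewrite norm_conj_autE ?(subsetP sXE) // -commgEl (subsetP cXH) ?mem_commg.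
have := subsetP BI _ Bh; rewrite Inn_conj_aut => /morphimP[e nEe Ee eq_he].
have Ehe : h * e^-1 \in E.
  apply: (subsetP cSE); rewrite inE groupM ?groupV ?(subsetP sES e) //=.
  rewrite -ker_conj_aut; apply/kerP; first by rewrite groupM ?groupV.
  by rewrite morphM ?groupV ?morphV //= eq_he mulgV.
by rewrite -(mulgKV e h) groupM.
Qed.

Hypothesis iK : #|E : 'Phi(E)| = (p ^ 2)%N.
Hypothesis neES : E :!=: S.

Let N := 'N_S(E)%G.
Let nsEN : E <| N.
Proof. by rewrite normalSG. Qed.
Let sEN : E \subset N := normal_sub nsEN.
Let pN : p.-group N := pgroupS (subsetIl S 'N(E)) pS.

Lemma norm_not_sub : ~~ (N \subset E).
Proof.
apply: contra neES => sNE.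
by rewrite (nilpotent_sub_norm (pgroup_nil pS) sES sNE).
Qed.

(** This is the degenerate chain with [X] equal to ['Phi(E)]. *)
Lemma comm_norm_not_sub_Phi : ~~ ([~: E, N] \subset 'Phi(E)).
Proof.
apply: contra norm_not_sub => cEN.
apply: (stab_chain_sub (Phi_char E)) => //.
by rewrite (subset_trans _ cEN) ?commSg ?Phi_sub.
Qed.

(** A characteristic subgroup strictly between would give a chain with both factors of order [p],
    hence centralised by the p-group [N], forcing [N] into [E]. *)
Lemma essential_char_irreducible : char_irreducible E.
Proof.
move=> X chX sPX; have sXE := char_sub chX.
have [-> | neXP] := eqVneq (X : {set gT}) 'Phi(E); first by left.
have [-> | neXE] := eqVneq (X : {set gT}) E; first by right.
case/negP: norm_not_sub.
have nsXN := char_normal_trans chX nsEN.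
have nsPN := char_normal_trans (Phi_char E) nsEN.
have [a iEX] := p_natP (pnat_dvd (dvdn_indexg E X) pE).
have [b iXP] := p_natP (pnat_dvd (dvdn_indexg X 'Phi(E)) (pgroupS sXE pE)).
have a_gt0 : 0 < a.
  rewrite lt0n; apply: contra neXE => /eqP a0; move/eqP: iEX.
  by rewrite a0 expn0 indexg_eq1 eqEsubset sXE.
have b_gt0 : 0 < b.
  rewrite lt0n; apply: contra neXP => /eqP b0; move/eqP: iXP.
  by rewrite b0 expn0 indexg_eq1 eqEsubset sPX andbT.
have /eqP : (a + b = 2)%N.
  apply/eqP; rewrite -(@eqn_exp2l p) ?prime_gt1 // expnD -iEX -iXP.
  by rewrite Lagrange_index // iK.
case: a b a_gt0 b_gt0 iEX iXP => [|[|a]] [|[|b]] //= _ _; last by rewrite !addnS.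
  rewrite expn1 => iEX iXP _; apply: (stab_chain_sub chX) => //.
    exact: (comm_sub_prime_index pr_p pN).
  exact: (comm_sub_prime_index pr_p pN).
by rewrite addnS.
Qed.

(** The centraliser of [E / 'Phi(E)] in [N] lies in [E] by the degenerate chain, and has index at
    most [p] because [E / 'Phi(E)] has order [p ^ 2]. *)
Lemma index_norm_essential : #|N : E| = p.
Proof.
have nsPN := char_normal_trans (Phi_char E) nsEN.
have nPN := normal_norm nsPN; have sPE := Phi_sub E.
have nPE := subset_trans sEN nPN.
pose C := (N :&: coset 'Phi(E) @*^-1 'C(E / 'Phi(E)))%G.
have sCN : C \subset N := subsetIl _ _.
have sCE : C \subset E.
  have cEC : [~: E, C] \subset 'Phi(E).
    have nPC := subset_trans sCN nPN.
    by rewrite commGC -quotient_cents2 // sub_quotient_pre // subsetIr.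
  apply: (stab_chain_sub (Phi_char E)) => //.
  by rewrite (subset_trans _ cEC) ?commSg ?Phi_sub.
have := @index_cent_card_le_p2 _ p (N / 'Phi(E))%G (E / 'Phi(E))%G pr_p.
rewrite quotient_pgroup // quotient_normal // card_quotient // iK leqnn.
move/(_ isT isT isT) => le_p.
have sCQ : 'C_(N / 'Phi(E))(E / 'Phi(E)) \subset E / 'Phi(E).
  rewrite -(cosetpreK 'C_(N / 'Phi(E))(E / 'Phi(E))) quotientS //.
  by rewrite morphpreI quotientGK.
have {}le_p : #|N : E| <= p.
  have sNPE : N :&: 'Phi(E) \subset E by rewrite subIset // sPE orbT.
  have := dvdn_leq (indexg_gt0 _ _) (indexgS (N / 'Phi(E))%G sCQ).
  by move/leq_trans/(_ le_p); rewrite (index_quotient_eq sNPE sEN nPN).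
have [a iNE] := p_natP (pnat_dvd (dvdn_indexg N E) pN).
move: le_p; rewrite iNE -{2}(expn1 p) leq_exp2l ?prime_gt1 //.
case: a iNE => [|[|a]] // /eqP.
by rewrite expn0 indexg_eq1 (negbTE norm_not_sub).
Qed.

Lemma moved_by_automorphism :
    ~ F_characteristic S homF E ->
  exists f : {morphism N >-> gT}, [/\ 'injm f, f @* N = N & f @* E != E].
Proof.
move=> notchar; have [homP _ _ _] := fusF.
have [nES | nEnS] := boolP (S \subset 'N(E)); last first.
  have ltNS : N \proper S.
    by rewrite properEneq subsetIl andbT; apply: contra nEnS => /eqP/setIidPl.
  have /properP[_ [x /setIP[Sx nNx] notNx]] :=
    nilpotent_proper_norm (pgroup_nil pS) ltNS.
  exists (conjgm_morphism N x); split; first exact: injm_conj.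
    exact: norm_conjg_im.
  rewrite morphim_conj (setIidPr sEN); apply: contra notNx => /eqP nEx.
  by rewrite inE Sx; apply/normP.
have defN : N :=: S by apply/setIidPl.
(* Boolean quantification over the finite set [homF S] turns the negated universal statement into a
   witness. *)
have /exists_inP[a homa neaE] : [exists a in homF S, a @: E != E].
  apply: contraT => /exists_inPn nex; case: notchar => a homa.
  by apply/eqP; rewrite -[_ == _]negbK; apply: nex.
have /and4P[_ _ /and3P[/forall_inP aM /forall_inP aI _] saS] := homP _ _ homa.
have morph_a : morphic N a.
  apply/morphicP=> x y; rewrite defN => Sx Sy; apply/eqP.
  exact: (forall_inP (aM x Sx)).
have fE (X : {set gT}) : X \subset S -> morphm morph_a @* X = a @: X.
  by move=> sXS; rewrite morphimEsub ?defN // morphmE.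
have injf : 'injm (morphm morph_a).
  apply/injmP=> x y Nx Ny /eqP eq_a.
  have [Sx Sy] : x \in S /\ y \in S by rewrite -defN.
  by apply/eqP; apply: implyP eq_a; apply: (forall_inP (aI x Sx)).
exists [morphism of morphm morph_a]; split=> //=; last by rewrite fE.
apply/eqP; rewrite eqEcard card_injm // leqnn andbT.
by rewrite fE ?defN.
Qed.

End EssentialRankTwo.

(** * Minimal numbers of generators and Frattini quotients *)

Section GeneratorRank.
Variables (gT : finGroupType) (p : nat) (G : {group gT}).
Hypotheses (pr_p : prime p) (pG : p.-group G).

(** The elementary abelian group [G / 'Phi(G)] has order [p] to the power of its own minimal number
    of generators, and a generating set of [G] maps onto one of the quotient. *)
Lemma index_Phi_le_grank : #|G : 'Phi(G)| <= p ^ grank G.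
Proof.
rewrite /grank; case: ex_minnP => n /existsP[B /andP[/eqP oB /eqP defG]] _.
have abQ := Phi_quotient_abelem pG; have nPG := normal_norm (Phi_normal G).
have [a oQ] := p_natP (quotient_pgroup 'Phi(G) pG).
rewrite -card_quotient // oQ leq_exp2l ?prime_gt1 //.
have -> : a = 'm(G / 'Phi(G)).
  by rewrite grank_abelian ?(abelem_abelian abQ) // (rank_abelem abQ) oQ pfactorK.
apply: leq_trans (quotient_grank nPG) _.
by rewrite -defG -oB grank_min.
Qed.

(** An index below [p ^ 2] would make the Frattini quotient cyclic, hence [G] cyclic and generated
    by a singleton, against minimality. *)
Lemma grank2_generators : grank G = 2 ->
  #|G : 'Phi(G)| = (p ^ 2)%N /\ exists x y, G :=: <[x]> <*> <[y]>.
Proof.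
move=> rG; split; last first.
  move: rG; rewrite /grank; case: ex_minnP => n /existsP[B /andP[/eqP oB /eqP defG]] _ n2.
  have /cards2P[x [y [_ defB]]] : #|B| == 2 by rewrite oB n2.
  by exists x, y; rewrite -defG defB joing_idl joing_idr.
have := index_Phi_le_grank; rewrite rG.
have [a oQ] := p_natP (pnat_dvd (dvdn_indexg G 'Phi(G)) pG).
rewrite oQ leq_exp2l ?prime_gt1 //.
rewrite leq_eqVlt => /predU1P[-> // | lt_a2].
have /cyclicP[x defG] : cyclic G.
  apply: Phi_quotient_cyclic.
  move: oQ; rewrite -card_quotient ?normal_norm ?Phi_normal //.
  case: a lt_a2 => [|[|//]] _ oQ; last by rewrite prime_cyclic // oQ expn1.
  have /eqP := oQ; rewrite expn0 -trivg_card1 => /eqP->; exact: cyclic1.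
move: rG; rewrite /grank; case: ex_minnP => n _ minn n2.
suff /(minn 1%N) : [exists B : {set gT}, (#|B| == 1%N) && (<<B>> == G)] by rewrite n2.
apply/existsP; exists [set x].
by rewrite cards1 eqxx /= defG.
Qed.

End GeneratorRank.

Theorem theorem2p6 (gT : finGroupType) (p : nat) (S : {group gT})
    (homF : {set gT} -> {set {ffun gT -> gT}}) (E : {group gT}) :
  prime p -> odd p -> p.-group S ->
  saturated_fusion_system p S homF ->
  F_essential p S homF E ->
  grank E = 2 -> grank 'Phi(E) <= 3 ->
  ~ F_characteristic S homF E ->
  F_pearl p S homF E.
Proof.
move=> pr_p odd_p pS [fusF _ _] essE rE rPhi notchar; split=> //.
have [sES fullE [M embM]] := essE; have [homP homS _ _] := fusF.
have pE := pgroupS sES pS.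
have [iK [x [y defE]]] := grank2_generators pr_p pE rE.
have cSE : 'C_S(E) \subset E.
  (* Conjugation by 1 is the inclusion of [E], which puts [E] in its own class. *)
  have [|//] := fullE E; apply/imsetP; exists (cmap E 1); first exact: homS.
  apply/setP=> z; apply/idP/imsetP=> [Ez | [w Ew ->]].
    by exists z; rewrite // ffunE Ez conjg1.
  by rewrite ffunE Ew conjg1.
(* Every morphism in [homF S] is an injection of the finite set [S] into itself, hence onto, so [S]
   is F-characteristic. *)
have neES : E :!=: S.
  apply: contra_not_neq notchar => defS a; rewrite defS => homa.
  have /and4P[_ _ /and3P[_ /forall_inP aI _] saS] := homP _ _ homa.
  apply/eqP; rewrite eqEcard saS card_in_imset ?leqnn // => u v Su Sv /eqP eq_a.
  by apply/eqP; apply: implyP eq_a; apply: (forall_inP (aI u Su)).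
have [f [injf fN fE]] := moved_by_automorphism pS fusF sES notchar.
have pN : p.-group 'N_S(E) := pgroupS (subsetIl _ _) pS.
have nsEN : E <| 'N_S(E) by rewrite normalSG.
have iE := index_norm_essential pr_p pS fusF sES embM cSE iK neES.
have irrE := essential_char_irreducible pr_p pS fusF sES embM cSE iK neES.
have ncEN := comm_norm_not_sub_Phi pr_p pS fusF sES embM cSE neES.
have neE : E :!=: (f @* E)%G by rewrite eq_sym.
apply: (pearl_of_moved_maximal pr_p odd_p pN nsEN iE iK defE irrE ncEN injf fN _ neE) => //.
apply: leq_trans (index_Phi_le_grank pr_p (pgroupS (Phi_sub E) pE)) _.
by rewrite leq_exp2l ?prime_gt1.
Qed.
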